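(* Let $m_1,m_2,m_3,m_4,m_5$ be positive integers. Then the graph $G=\mathbb{K}[C_5](m_1,m_2,m_3,m_4,m_5)$ is $k$-indicated colorable for all $k\geq\chi(G)$.
   Context: All graphs are finite, simple and undirected; $\chi(G)$ is the chromatic number. $\mathbb{K}[C_5](m_1,\dots,m_5)$ (the complete expansion of $C_5$) is the graph obtained from the cycle $C_5$ with vertices $v_1,\dots,v_5$ (in cyclic order) by replacing each $v_i$ by a complete graph $K_{m_i}$ (these being vertex-disjoint) and joining every vertex of the $i$-th complete graph to every vertex of the $j$-th whenever $v_iv_j\in E(C_5)$. Indicated coloring game on $G$ with a fixed set of $k$ colors: in each round Ann selects an uncolored vertex, and then Ben assigns it one of the $k$ colors not already used on its neighbors (so that the partial coloring stays proper). Ann wins if the whole graph gets properly colored; Ben wins if at some stage there is an uncolored vertex all $k$ colors of which appear on its neighbors. $G$ is $k$-indicated colorable if Ann has a winning strategy (regardless of how Ben plays) with $k$ colors. *)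

(* Defs.v *)
From mathcomp Require Import all_boot.
Set Implicit Arguments.
Unset Strict Implicit.
Unset Printing Implicit Defensive.

Record graph := Graph {
  vertex :> finType;
  adj : rel vertex;
  adj_sym : symmetric adj;
  adj_irr : irreflexive adj }.

Definition proper_coloring (G : graph) (k : nat) (f : {ffun G -> 'I_k}) : bool :=
  [forall x, forall y, adj x y ==> (f x != f y)].

Definition colorable (G : graph) (k : nat) : bool :=
  [exists f : {ffun G -> 'I_k}, proper_coloring f].

Lemma colorable_card (G : graph) : exists k, colorable G k.
Proof.
exists #|G|; apply/existsP; exists [ffun x => enum_rank x].
apply/forallP => x; apply/forallP => y; apply/implyP => exy.
rewrite !ffunE (inj_eq enum_rank_inj).
by apply: contraTneq exy => ->; rewrite adj_irr.
Qed.

Definition chromatic_number (G : graph) : nat := ex_minn (colorable_card G).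

Definition C5_adj : rel 'I_5 := fun i j => (j == ordS i) || (i == ordS j).

Lemma C5_adj_sym : symmetric C5_adj.
Proof. by move=> i j; rewrite /C5_adj orbC. Qed.

Lemma C5_adj_irr : irreflexive C5_adj.
Proof. by case=> [[|[|[|[|[|i]]]]]]. Qed.

Definition C5 : graph := Graph C5_adj_sym C5_adj_irr.

Section CompleteExpansion.

Variables (H : graph) (m : H -> nat).

(* The vertex Tagged _ a with tag v is the a-th vertex of the clique K_(m v)
   that replaces v. *)
Definition expansion_vertex : finType := {v : H & 'I_(m v)}.

Definition expansion_adj : rel expansion_vertex := fun x y =>
  if tag x == tag y then x != y else adj (tag x) (tag y).

Lemma expansion_adj_sym : symmetric expansion_adj.
Proof.
by move=> x y; rewrite /expansion_adj eq_sym [x == y]eq_sym adj_sym.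
Qed.

Lemma expansion_adj_irr : irreflexive expansion_adj.
Proof. by move=> x; rewrite /expansion_adj !eqxx. Qed.

Definition complete_expansion : graph :=
  Graph expansion_adj_sym expansion_adj_irr.

End CompleteExpansion.

Section IndicatedColoring.

Variables (G : graph) (k : nat).

Definition partial_coloring := {ffun G -> option 'I_k}.

Implicit Types (c : partial_coloring) (v : G) (a : 'I_k).

Definition empty_coloring : partial_coloring := [ffun=> None].

Definition uncolored c v : bool := c v == None.

Definition available c v a : bool := [forall w, adj v w ==> (c w != Some a)].

Definition color_vertex c v a : partial_coloring :=
  [ffun w => if w == v then Some a else c w].

Definition all_colored c : bool := [forall v, ~~ uncolored c v].

Definition ben_wins c : bool :=
  [exists v, uncolored c v && [forall a, ~~ available c v a]].

(* The current partial coloring carries all the information relevant to the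
   rest of the game, so Ann's choice depends on it alone; None means that she
   selects no vertex. *)
Definition ann_strategy := partial_coloring -> option G.

(* The positions that can arise when Ann follows s and Ben replies with
   arbitrary available colors. *)
Inductive reachable (s : ann_strategy) : partial_coloring -> Prop :=
| reachable_start : reachable s empty_coloring
| reachable_round c v a :
    reachable s c -> s c = Some v -> uncolored c v -> available c v a ->
    reachable s (color_vertex c v a).

(* Each round colors one more vertex, so a play in which Ben never wins and
   Ann always has a legal selection ends with every vertex colored. *)
Definition winning_strategy (s : ann_strategy) : Prop :=
  forall c, reachable s c ->
    ~~ ben_wins c /\
    (all_colored c \/ exists2 v, s c = Some v & uncolored c v).

Definition indicated_colorable : Prop := exists s, winning_strategy s.

End IndicatedColoring.

(* Main.v *)
(* A proper coloring with at most k colors gives m_i + m_(i+1) <= k and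
   m_0 + ... + m_4 <= 2k, and these inequalities suffice for Ann.  Let A_i be
   the set of colors used on the i-th clique.  Ann first asks only for vertices
   of the nonadjacent cliques 0 and 2, until one of the following happens:
   - |A_0 n A_2| = k - m_3 - m_4: she completes 3 and 4, then 0
     and 2.  As A_0 n A_2 only grows, |A_0 u A_2| ends up at most
     m_0 + m_2 + m_3 + m_4 - k <= k - m_1, which leaves enough colors for 1.
   - |A_0 u A_2| = k - m_1, or the cliques 0 and 2 are complete: she completes
     1, whose colors are then all those outside A_0 u A_2 in the former case,
     then 0 and 2.  As |A_0 n A_2| <= k - m_3 - m_4, she can complete 3 and 4.
*)
Require Import Defs.
From mathcomp Require Import all_boot zify.
Set Implicit Arguments.
Unset Strict Implicit.
Unset Printing Implicit Defensive.

(** * The coloring game as a finite game tree *)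

Section Game.

Variables (G : graph) (k : nat).
Implicit Types (c : partial_coloring G k) (v : G) (a : 'I_k).

Definition uncolored_set c : {set G} := [set v | uncolored c v].

(** Backward induction with [n] rounds left. Requiring an available color keeps Ann from winning
    vacuously by selecting a stuck vertex. *)
Fixpoint ann_wins n c : bool :=
  if n is n'.+1 then
    [exists v, [&& uncolored c v, [exists a, available c v a] &
      [forall a, available c v a ==> ann_wins n' (color_vertex c v a)]]]
  else all_colored c.

Lemma uncolored_color_vertex c v a :
  uncolored_set (color_vertex c v a) = uncolored_set c :\ v.
Proof.
by apply/setP=> w; rewrite !inE /uncolored ffunE; case: (eqVneq w v).
Qed.

Lemma card_uncolored_color_vertex c v a : uncolored c v ->
  #|uncolored_set (color_vertex c v a)| = #|uncolored_set c|.-1.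
Proof.
by move=> uv; rewrite uncolored_color_vertex [in RHS](cardsD1 v) inE uv.
Qed.

(** A stuck vertex stays stuck: the vertex that Ann selects has an available color, so it is another
    one, and coloring it frees no color. At the end no vertex is left uncolored. *)
Lemma ann_wins_not_ben_wins n c : ann_wins n c -> ~~ ben_wins c.
Proof.
elim: n c => [|n IHn] c /=.
  move=> /forallP colc; apply/existsPn=> v.
  by rewrite negb_and (negPf (colc v)).
case/existsP=> v /and3P[uv /existsP[a avv] /forallP win].
have /existsPn nben := IHn _ (implyP (win a) avv).
apply/existsPn=> w; apply/negP=> /andP[uw /forallP stuck].
have neq_wv: w != v by apply: contraTneq avv => <-; apply: stuck.
have:= nben w; rewrite /uncolored ffunE (negPf neq_wv).
rewrite -/(uncolored c w) uw /= => /forallPn[b]; rewrite negbK => avb.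
have /negP[] := stuck b; apply/forallP=> x; apply/implyP=> wx.
have:= implyP (forallP avb x) wx; rewrite ffunE.
by case: (x =P v) => // -> _; rewrite (eqP uv).
Qed.

(** The number of remaining rounds is the number of uncolored vertices, hence a function of the
    position, so picking any [good] vertex is a strategy depending on the position alone. *)
Lemma ann_wins_indicated_colorable :
  ann_wins #|uncolored_set (empty_coloring G k)| (empty_coloring G k) ->
  indicated_colorable G k.
Proof.
move=> win0.
pose good c v := uncolored c v &&
  [forall a, available c v a ==>
     ann_wins #|uncolored_set c|.-1 (color_vertex c v a)].
exists (fun c => [pick v | good c v]) => c rc.
have winc: ann_wins #|uncolored_set c| c.
  elim: rc => {c} // c v a _ _; case: pickP => // w /andP[uw /forallP win] [<-].
  by move=> _ av; rewrite card_uncolored_color_vertex // (implyP (win a)).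
split; first exact: ann_wins_not_ben_wins winc.
case: pickP => [v /andP[uv _] | nogood]; first by right; exists v.
left; case E: #|uncolored_set c| winc => [|n] //=.
case/existsP=> v /and3P[uv _ win].
by have := nogood v; rewrite /good uv E win.
Qed.

End Game.

(** * The game on sets of colors *)

Section SetGame.

Variables (H : graph) (m : H -> nat) (T : finType).

Implicit Types (U : {ffun H -> {set T}}) (v w : H) (a : T) (X : {set T}).

Definition blocked U v : {set T} := \bigcup_(w | adj v w) U w.

Definition set_colors U v X : {ffun H -> {set T}} :=
  [ffun w => if w == v then X else U w].

(* The vertices of a clique are interchangeable, so a position is described
   by the set of colors used on each clique. *)
Inductive set_game_won U : Prop :=
| set_game_full : (forall v, m v <= #|U v|) -> set_game_won U
| set_game_round v :
    #|U v| < m v -> (exists a, a \notin U v :|: blocked U v) ->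
    (forall a, a \notin U v :|: blocked U v ->
       set_game_won (set_colors U v (a |: U v))) ->
    set_game_won U.

Lemma exists_notin X : #|X| < #|T| -> exists a, a \notin X.
Proof.
move=> ltk; have: 0 < #|~: X| by rewrite -(leq_add2l #|X|) cardsC addn1.
by case/card_gt0P=> a; rewrite inE; exists a.
Qed.

(** Ann asks for [v] until it is complete. The colors blocked by its neighbors do not change
    meanwhile, so a free color remains while fewer than [m v] are used; [X] is whatever set Ben
    produces. *)
Lemma set_game_fill U v :
  #|U v| <= m v -> m v + #|blocked U v| <= #|T| ->
  [disjoint U v & blocked U v] ->
  (forall X, U v \subset X -> #|X| = m v -> [disjoint X & blocked U v] ->
     set_game_won (set_colors U v X)) ->
  set_game_won U.
Proof.
have blockedE X : blocked (set_colors U v X) v = blocked U v.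
  apply: eq_bigr => w vw; rewrite ffunE.
  by case: eqP vw => // ->; rewrite adj_irr.
move=> le_m le_k dis win.
(* With the base [U] fixed and only [X] varying, successive updates at [v] collapse into one. *)
suff fill n X : n = m v - #|X| -> U v \subset X -> #|X| <= m v ->
    [disjoint X & blocked U v] -> set_game_won (set_colors U v X).
  have <- : set_colors U v (U v) = U.
    by apply/ffunP=> w; rewrite ffunE; case: eqP => // ->.
  exact: (fill (m v - #|U v|)).
elim: n X => [|n IHn] X En sUX leX disX; first by apply: win => //; lia.
have EX: set_colors U v X v = X by rewrite ffunE eqxx.
apply: (@set_game_round _ v); rewrite ?EX ?blockedE; first by lia.
  apply: exists_notin; have := cardsU X (blocked U v); lia.
move=> a; rewrite inE negb_or => /andP[aX aN].
have -> : set_colors (set_colors U v X) v (a |: X) = set_colors U v (a |: X).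
  by apply/ffunP=> w; rewrite !ffunE; case: eqP.
apply: IHn; rewrite ?cardsU1 ?aX; try lia.
  by rewrite subsetU // sUX orbT.
by rewrite disjoints_subset subUset sub1set inE aN -disjoints_subset.
Qed.

End SetGame.

(** * From the set game to the coloring game on the expansion *)

Section Transfer.

Variables (H : graph) (m : H -> nat) (k : nat).

Local Notation G := (@complete_expansion H m).

Implicit Types (c : partial_coloring G k) (v : H) (a : 'I_k).

Definition used_colors c : {ffun H -> {set 'I_k}} :=
  [ffun v => [set a | [exists x : G, (tag x == v) && (c x == Some a)]]].

Lemma used_colorsP (c : partial_coloring G k) v a :
  reflect (exists2 x : G, tag x = v & c x = Some a) (a \in used_colors c v).
Proof.
rewrite ffunE inE; apply: (iffP existsP) => [[x /andP[/eqP ? /eqP ?]]|[x ? ?]].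
  by exists x.
by exists x; apply/andP; split; apply/eqP.
Qed.

(** As [x] is uncolored, every colored vertex of its own clique is a neighbor. *)
Lemma availableE c (x : G) a : uncolored c x ->
  available c x a =
    (a \notin used_colors c (tag x) :|: blocked (used_colors c) (tag x)).
Proof.
move=> /eqP ux; apply/idP/idP.
  move=> /forallP av; rewrite inE negb_or; apply/andP; split.
    apply/negP=> /used_colorsP[y ty cy]; have /implyP := av y.
    rewrite cy eqxx => /(_ _)/negP[] //.
    rewrite /= /expansion_adj ty eqxx.
    by apply: contra_eq_neq cy => <-; rewrite ux.
  apply/negP=> /bigcupP[w xw /used_colorsP[y ty cy]]; have /implyP := av y.
  rewrite cy eqxx => /(_ _)/negP[] //.
  rewrite /= /expansion_adj ty; case: eqP xw => // ->.
  by rewrite adj_irr.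
rewrite inE negb_or => /andP[/negP nU /negP nN]; apply/forallP=> y.
apply/implyP; rewrite /= /expansion_adj.
case: eqP => [txy _ | _ xy]; apply/negP=> /eqP cy.
  by apply: nU; apply/used_colorsP; exists y.
by apply: nN; apply/bigcupP; exists (tag y) => //; apply/used_colorsP; exists y.
Qed.

Lemma used_colors_color_vertex c (x : G) a :
  uncolored c x ->
  used_colors (color_vertex c x a) =
    set_colors (used_colors c) (tag x) (a |: used_colors c (tag x)).
Proof.
move=> /eqP ux; apply/ffunP=> v; rewrite [RHS]ffunE; apply/setP=> b.
apply/used_colorsP/idP => [[y ty]|].
  rewrite ffunE; case: eqP => [eyx [<-]|_ cy].
    by rewrite -ty eyx eqxx !inE eqxx.
  have bv: b \in used_colors c v by apply/used_colorsP; exists y.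
  by case: eqP bv => [->|//]; rewrite inE orbC => ->.
have keep w : b \in used_colors c w ->
    exists2 y : G, tag y = w & color_vertex c x a y = Some b.
  case/used_colorsP=> y ty cy; exists y => //; rewrite ffunE.
  by case: eqP => // eyx; rewrite eyx ux in cy.
case: eqP => [->|_]; last exact: keep.
rewrite in_setU1 => /predU1P[->|]; last exact: keep.
by exists x => //; rewrite ffunE eqxx.
Qed.

Definition proper_partial (c : partial_coloring G k) : Prop :=
  forall (x y : G) a, adj x y -> c x = Some a -> c y <> Some a.

Lemma proper_color_vertex c (x : G) a :
  proper_partial c -> available c x a -> proper_partial (color_vertex c x a).
Proof.
move=> pc /forallP av y z b yz; rewrite !ffunE.
case: eqP => [eyx|_]; case: eqP => [ezx|_].
- by move: yz; rewrite eyx ezx adj_irr.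
- by move=> [<-]; apply/eqP; apply: (implyP (av z)); rewrite -eyx.
- move=> cy [eab]; have /implyP := av y.
  by rewrite -ezx adj_sym yz eab cy eqxx => /(_ isT).
- exact: pc.
Qed.

Lemma card_clique v : #|[set x : G | tag x == v]| = m v.
Proof.
have -> : [set x : G | tag x == v] = [set (Tagged _ i : G) | i : 'I_(m v)].
  apply/setP=> x; rewrite inE; apply/eqP/imsetP => [|[i _ ->] //].
  by case: x => w i /= ew; subst w; exists i.
rewrite card_imset ?card_ord // => i j /eqP; rewrite eq_Tagged /=.
by move/eqP.
Qed.

(** A proper coloring is injective on a clique, so a fully colored clique would show [m v]
    colors. *)
Lemma set_game_uncolored c v :
  proper_partial c -> #|used_colors c v| < m v ->
  exists2 x : G, tag x = v & uncolored c x.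
Proof.
move=> pc lt_m; case: (pickP [pred x : G | (tag x == v) && uncolored c x]).
  by move=> x /andP[/eqP]; exists x.
move=> colv; suff: m v <= #|used_colors c v| by rewrite leqNgt lt_m.
rewrite -card_clique.
have {}colv (x : G) : tag x = v -> exists a, c x = Some a.
  move=> tx; move: (colv x); rewrite /= tx eqxx /uncolored.
  by case: (c x) => // a _; exists a.
pose S := [set x : G | tag x == v].
rewrite -(card_in_imset (f := c) (D := S)).
  have <- : #|[set Some a | a in used_colors c v]| = #|used_colors c v|.
    by apply: card_imset => a b [].
  apply/subset_leq_card/subsetP=> b /imsetP[x]; rewrite inE => /eqP tx ->.
  have [a ca] := colv x tx; rewrite ca; apply/imsetP; exists a => //.
  by apply/used_colorsP; exists x.
move=> x y; rewrite !inE => /eqP tx /eqP ty exy; apply/eqP.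
have [a ca] := colv x tx; apply/negP=> /negP nxy.
case: (pc x y a) => //; last by rewrite -exy.
by rewrite /= /expansion_adj tx ty eqxx.
Qed.

(** An uncolored vertex would leave only [m v - 1] vertices of its clique to carry [m v] colors. *)
Lemma full_all_colored (c : partial_coloring G k) :
  (forall v, m v <= #|used_colors c v|) -> all_colored c.
Proof.
move=> full; apply/forallP=> x; apply/negP=> /eqP ux.
have := full (tag x); rewrite leqNgt -card_clique => /negP[].
pose S := [set y : G | tag y == tag x].
rewrite (cardsD1 x) inE eqxx add1n ltnS.
have <- : #|[set Some a | a in used_colors c (tag x)]| =
          #|used_colors c (tag x)|.
  by apply: card_imset => a b [].
apply: leq_trans (leq_imset_card c _); apply/subset_leq_card/subsetP=> b.
case/imsetP=> a /used_colorsP[y ty cy] ->; apply/imsetP; exists y => //.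
by rewrite !inE ty eqxx andbT; apply: contra_eq_neq cy => ->; rewrite ux.
Qed.

(** Induction on the set-game derivation: a round at [v] becomes the selection of any uncolored
    vertex of that clique, and Ben has the same colors to choose from in both games. *)
Lemma set_game_ann_wins (c : partial_coloring G k) :
  proper_partial c -> set_game_won m (used_colors c) ->
  ann_wins #|uncolored_set c| c.
Proof.
move=> pc; move Ec: (used_colors c) => U winU.
elim: winU c pc Ec => {}U => [full | v lt_m [a free_a] _ IH] c pc Ec.
  have colc: all_colored c by apply: full_all_colored; rewrite Ec.
  suff -> : uncolored_set c = set0 by rewrite cards0.
  by apply/setP=> x; rewrite !inE; apply/negbTE/(forallP colc).
have [|x tx ux] := set_game_uncolored (v := v) pc; first by rewrite Ec.
rewrite (cardsD1 x) inE ux /=; apply/existsP; exists x; rewrite ux /=.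
have avE b : available c x b = (b \notin U v :|: blocked U v).
  by rewrite availableE // Ec tx.
apply/andP; split; first by apply/existsP; exists a; rewrite avE.
apply/forallP=> b; apply/implyP=> avb; rewrite -(uncolored_color_vertex c x b).
apply: (IH b); first by rewrite -avE.
  exact: proper_color_vertex.
by rewrite used_colors_color_vertex // Ec tx.
Qed.

Lemma set_game_indicated_colorable :
  set_game_won m [ffun=> set0 : {set 'I_k}] ->
  indicated_colorable G k.
Proof.
move=> win; apply/ann_wins_indicated_colorable/set_game_ann_wins.
  by move=> x y a _; rewrite ffunE.
congr set_game_won: win; apply/ffunP=> v; rewrite ffunE; apply/setP=> a.
by rewrite inE; apply/esym/used_colorsP=> -[x _]; rewrite ffunE.
Qed.

Lemma colorable_color_sets : colorable G k ->
  exists2 U : H -> {set 'I_k}, forall v, m v <= #|U v| &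
    forall v w, adj v w -> [disjoint U v & U w].
Proof.
case/existsP=> f /forallP proper_f.
have proper (x y : G) : adj x y -> f x != f y.
  exact/implyP/(forallP (proper_f x)).
(* Viewed as a partial coloring with no uncolored vertex, [f] must show [m v] colors on each
   clique. *)
pose c : partial_coloring G k := [ffun x => Some (f x)].
exists (used_colors c) => [v | v w vw].
  rewrite leqNgt; apply/negP=> /set_game_uncolored[].
    move=> x y a /proper; rewrite !ffunE => fxy [<-] [] /eqP.
    by rewrite eq_sym (negPf fxy).
  by move=> x _; rewrite /uncolored ffunE.
rewrite -setI_eq0; apply/eqP/setP=> a; rewrite !inE; apply/negP=> /andP[].
case/used_colorsP=> x tx; rewrite ffunE => -[fx].
case/used_colorsP=> y ty; rewrite ffunE => -[fy].
suff /proper: adj x y by rewrite fx fy eqxx.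
rewrite /= /expansion_adj tx ty; case: eqP vw => // ->.
by rewrite adj_irr.
Qed.

End Transfer.

(** * The set game on the five-cycle *)

Section PentagonGame.

Variables (m : 'I_5 -> nat) (T : finType) (k : nat).
Hypothesis card_T : #|T| = k.

Implicit Types (A D X Y : {set T}) (s : seq {set T}) (i : 'I_5).

Lemma disjoint_set0l A : [disjoint set0 & A].
Proof. by rewrite disjoints_subset sub0set. Qed.

Lemma disjoint_setUr X A D :
  [disjoint X & A :|: D] = [disjoint X & A] && [disjoint X & D].
Proof. by rewrite -!setI_eq0 setIUr setU_eq0. Qed.

(** Positions are lists, so that lookups and updates at concrete indices compute. *)
Definition pentagon s : {ffun C5 -> {set T}} :=
  [ffun i : 'I_5 => nth set0 s i].

Local Notation won s := (@set_game_won C5 m T (pentagon s)).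

Lemma set_colors_pentagon s i X :
  set_colors (pentagon s) i X = pentagon (set_nth set0 s i X).
Proof. by apply/ffunP=> j; rewrite !ffunE nth_set_nth. Qed.

(** The two lists tabulate predecessor and successor on the cycle. *)
Lemma blocked_pentagon s i :
  blocked (pentagon s) i =
    nth set0 s (nth 0 [:: 4; 0; 1; 2; 3] i) :|:
    nth set0 s (nth 0 [:: 1; 2; 3; 4; 0] i).
Proof.
rewrite /blocked big_mkcond !big_ord_recl big_ord0 !ffunE /= /C5_adj setU0.
by case: i => [[|[|[|[|[|i]]]]] lti] //=; rewrite ?set0U ?setU0 // setUC.
Qed.

Lemma pentagon_fill i s
    (A := nth set0 s i)
    (N := nth set0 s (nth 0 [:: 4; 0; 1; 2; 3] i) :|:
          nth set0 s (nth 0 [:: 1; 2; 3; 4; 0] i)) :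
  #|A| <= m i -> m i + #|N| <= k -> [disjoint A & N] ->
  (forall X, A \subset X -> #|X| = m i -> [disjoint X & N] ->
     won (set_nth set0 s i X)) ->
  won s.
Proof.
move=> leA leN dis win; apply: (@set_game_fill C5 m T _ i).
- by rewrite ffunE.
- by rewrite blocked_pentagon card_T.
- by rewrite ffunE blocked_pentagon.
by move=> X; rewrite ffunE blocked_pentagon set_colors_pentagon; apply: win.
Qed.

Lemma pentagon_round i s
    (A := nth set0 s i)
    (N := nth set0 s (nth 0 [:: 4; 0; 1; 2; 3] i) :|:
          nth set0 s (nth 0 [:: 1; 2; 3; 4; 0] i)) :
  #|A| < m i -> #|A| + #|N| < k ->
  (forall a, a \notin A -> a \notin N -> won (set_nth set0 s i (a |: A))) ->
  won s.
Proof.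
move=> ltA ltN win.
have EA : pentagon s i = A by rewrite ffunE.
apply: (@set_game_round C5 m T _ i); rewrite EA // blocked_pentagon -/N.
  by apply: exists_notin; rewrite card_T; have := cardsU A N; lia.
by move=> a; rewrite inE negb_or set_colors_pentagon => /andP[]; apply: win.
Qed.

Local Notation i0 := (@Ordinal 5 0 isT).
Local Notation i1 := (@Ordinal 5 1 isT).
Local Notation i2 := (@Ordinal 5 2 isT).
Local Notation i3 := (@Ordinal 5 3 isT).
Local Notation i4 := (@Ordinal 5 4 isT).

(* Ann asks for the clique 3 until the colors still allowed on the clique 4
   just suffice for it; then she completes 4 before 3. *)
Lemma pentagon_fill_edge A0 A1 A2 D :
  #|D| <= m i3 -> [disjoint D & A2] ->
  m i3 + #|A2| <= k -> #|A0 :|: D| + m i4 <= k ->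
  m i3 + m i4 + #|A0 :&: A2| <= k ->
  (forall X Y, #|X| = m i3 -> #|Y| = m i4 ->
     [disjoint X & A2] -> [disjoint Y & A0] -> [disjoint X & Y] ->
     won [:: A0; A1; A2; X; Y]) ->
  won [:: A0; A1; A2; D; set0].
Proof.
move=> leD disD le3 le4 le34 win.
move En: (m i3 - #|D|) => n.
elim: n D leD disD le4 En => [|n IHn] D leD disD le4 En.
  apply: (pentagon_fill (i := i4)); rewrite /= ?cards0 ?disjoint_set0l //.
    by rewrite setUC addnC.
  move=> Y _ cardY; rewrite disjoint_setUr.
  case/andP=> disDY disAY; apply: win => //; first by lia.
  by rewrite disjoint_sym.
have [lt4 | tight] := ltnP (#|A0 :|: D| + m i4) k.
  apply: (pentagon_round (i := i3)) => /=; first by lia.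
    rewrite setU0; lia.
  move=> a aD; rewrite setU0 => aA2; apply: IHn; rewrite ?cardsU1 ?aD; try lia.
    by rewrite disjoints_subset subUset sub1set inE aA2 -disjoints_subset.
  by rewrite setUCA cardsU1; lia.
apply: (pentagon_fill (i := i4)); rewrite /= ?cards0 ?disjoint_set0l //.
  by rewrite setUC addnC.
move=> Y _ cardY; rewrite disjoint_setUr.
case/andP=> disDY disAY.
(* By tightness [A0 :|: D] has at least [k - m i4] colors, and [Y] supplies [m i4] others. *)
have all_used : (A0 :|: D) :|: Y = setT.
  apply/eqP; rewrite eqEcard subsetT /= cardsT card_T cardsU.
  suff -> : (A0 :|: D) :&: Y = set0 by rewrite cards0; lia.
  by rewrite setIC; apply/disjoint_setI0; rewrite disjoint_setUr disAY.
(* [D] misses [A2], so a color of [A2] outside [Y] lies in [A0]. Hence [A2 :|: Y] has at most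
   [m i4 + #|A0 :&: A2|] colors, which leaves [m i3] for clique 3. *)
have sub2 : A2 :\: Y \subset A0 :&: A2.
  apply/subsetP=> a; rewrite !inE => /andP[aY aA2]; rewrite aA2 andbT.
  have := in_setT a; rewrite -all_used !inE (negPf aY) orbF.
  by case/orP=> // aD; have := disjointFr disD aD; rewrite aA2.
apply: (pentagon_fill (i := i3)) => //=.
- have := subset_leq_card sub2; have := cardsD A2 Y; have := cardsU A2 Y.
  have := subset_leq_card (subsetIl A2 Y); lia.
- by rewrite disjoint_setUr disD disjoint_sym.
move=> X _ cardX; rewrite disjoint_setUr.
by case/andP=> disXA2 disXY; apply: win.
Qed.

Hypothesis edge_le :
  [/\ m i0 + m i1 <= k, m i1 + m i2 <= k, m i2 + m i3 <= k,
      m i3 + m i4 <= k & m i4 + m i0 <= k].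
Hypothesis total_le : m i0 + m i1 + m i2 + m i3 + m i4 <= 2 * k.

Lemma pentagon_full A0 A1 A2 A3 A4 :
  #|A0| = m i0 -> #|A1| = m i1 -> #|A2| = m i2 -> #|A3| = m i3 ->
  #|A4| = m i4 -> won [:: A0; A1; A2; A3; A4].
Proof.
move=> e0 e1 e2 e3 e4; apply: set_game_full => -[[|[|[|[|[|i]]]]] lti] //;
  by rewrite (bool_irrelevance lti isT) ffunE /= ?e0 ?e1 ?e2 ?e3 ?e4.
Qed.

Lemma pentagon_won_full012 A0 A1 A2 :
  #|A0| = m i0 -> #|A1| = m i1 -> #|A2| = m i2 ->
  #|A0 :&: A2| + m i3 + m i4 <= k -> won [:: A0; A1; A2; set0; set0].
Proof.
case: edge_le => le01 le12 le23 le34 le40 e0 e1 e2 le.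
apply: pentagon_fill_edge; rewrite ?cards0 ?disjoint_set0l ?setU0 //; try lia.
by move=> X Y eX eY _ _ _; apply: pentagon_full.
Qed.

Lemma pentagon_won_tight_union A0 A2 :
  #|A0| <= m i0 -> #|A2| <= m i2 -> #|A0 :|: A2| + m i1 <= k ->
  k <= #|A0 :|: A2| + m i1 \/
    [/\ #|A0| = m i0, #|A2| = m i2 & #|A0 :&: A2| + m i3 + m i4 <= k] ->
  won [:: A0; set0; A2; set0; set0].
Proof.
case: edge_le => le01 le12 le23 le34 le40 le0 le2 leU cond.
apply: (pentagon_fill (i := i1)); rewrite /= ?cards0 ?disjoint_set0l //.
  by rewrite addnC.
move=> A1 _ e1; rewrite disjoint_setUr => /andP[dis10 dis12].
(* Cliques 3 and 4 are still empty, so only [A1] restricts 0 and 2, and [edge_le] gives room for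
   both. *)
apply: (pentagon_fill (i := i0)); rewrite /= ?set0U ?e1
  ?[[disjoint A0 & _]]disjoint_sym //.
move=> X0 sub0 e0 _.
apply: (pentagon_fill (i := i2)); rewrite /= ?setU0 ?e1
  ?[[disjoint A2 & _]]disjoint_sym //.
  by rewrite addnC.
move=> X2 sub2 e2 _; apply: pentagon_won_full012 => //.
case: cond => [ge | [e0' e2' le]].
  (* The union has at least [k - m i1] colors, so the intersection has at most
     [m i0 + m i2 + m i1 - k], and [total_le] bounds this by [k - m i3 - m i4]. *)
  have := subset_leq_card (setUSS sub0 sub2); have := cardsUI X0 X2; lia.
have -> : X0 = A0 by apply/esym/eqP; rewrite eqEcard sub0 e0 e0' /=.
by have -> : X2 = A2 by apply/esym/eqP; rewrite eqEcard sub2 e2 e2' /=.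
Qed.

Lemma pentagon_won_tight_inter A0 A2 :
  #|A0| <= m i0 -> #|A2| <= m i2 -> #|A0 :&: A2| + m i3 + m i4 = k ->
  won [:: A0; set0; A2; set0; set0].
Proof.
case: edge_le => le01 le12 le23 le34 le40 le0 le2 eqI.
apply: pentagon_fill_edge; rewrite ?cards0 ?disjoint_set0l ?setU0 //; try lia.
move=> A3 A4 e3 e4 dis32 dis40 _.
(* Clique 1 is still empty, so 0 competes only with 4, and then 2 only with 3. *)
apply: (pentagon_fill (i := i0)); rewrite /= ?setU0 ?e4 //
  1?disjoint_sym //; try lia.
move=> X0 sub0 e0 _.
apply: (pentagon_fill (i := i2)); rewrite /= ?set0U ?e3 //
  1?disjoint_sym //; try lia.
move=> X2 sub2 e2 _.
apply: (pentagon_fill (i := i1)); rewrite /= ?cards0 ?disjoint_set0l //.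
  have := subset_leq_card (setISS sub0 sub2); have := cardsUI X0 X2; lia.
by move=> X1 _ e1 _; apply: pentagon_full.
Qed.

(** One more color raises [#|A0 :&: A2|] and [#|A0 :|: A2|] by at most one each, so both bounds
    survive a round as long as both are strict. The induction is on the number of colors still
    missing on 0 and 2. *)
Lemma pentagon_won A0 A2 :
  #|A0| <= m i0 -> #|A2| <= m i2 ->
  #|A0 :&: A2| + m i3 + m i4 <= k -> #|A0 :|: A2| + m i1 <= k ->
  won [:: A0; set0; A2; set0; set0].
Proof.
case: edge_le => le01 le12 le23 le34 le40.
move En: (m i0 + m i2 - (#|A0| + #|A2|)) => n.
elim: n => [|n IHn] in A0 A2 En * => le0 le2 leI leU.
  by apply: pentagon_won_tight_union => //; right; split=> //; lia.
have [geI|ltI] := leqP k (#|A0 :&: A2| + m i3 + m i4).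
  by apply: pentagon_won_tight_inter => //; lia.
have [geU|ltU] := leqP k (#|A0 :|: A2| + m i1).
  by apply: pentagon_won_tight_union => //; left.
have step a X Y : a \notin X ->
    #|(a |: X) :&: Y| <= #|X :&: Y|.+1 /\ #|(a |: X) :|: Y| <= #|X :|: Y|.+1.
  move=> aX; rewrite -setUA setIUl !cardsU1; split; last by case: (_ \notin _).
  by have := cardsU ([set a] :&: Y) (X :&: Y); 
     have := subset_leq_card (subsetIl [set a] Y); rewrite cards1; lia.
have [lt0|ge0] := ltnP #|A0| (m i0).
  apply: (pentagon_round (i := i0)); rewrite /= ?setU0 ?cards0 //; first by lia.
  move=> a aA0 _; have [stepI stepU] := step a A0 A2 aA0.
  by apply: IHn; rewrite ?cardsU1 ?aA0 //; lia.
apply: (pentagon_round (i := i2)); rewrite /= ?setU0 ?cards0 //; try lia.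
move=> a aA2 _; have [] := step a A2 A0 aA2.
rewrite ![_ :&: A0]setIC ![_ :|: A0]setUC => stepI stepU.
by apply: IHn; rewrite ?cardsU1 ?aA2 //; lia.
Qed.

End PentagonGame.

(** * Inequalities from a proper coloring, and the conclusion *)

Theorem theorem3p6 (m : 'I_5 -> nat) (m_gt0 : forall i, 0 < m i) (k : nat) :
  chromatic_number (@complete_expansion C5 m) <= k ->
  indicated_colorable (@complete_expansion C5 m) k.
Proof.
rewrite /chromatic_number; case: ex_minnP => n colG _ le_nk.
(* The coloring with [n] colors serves only to yield inequalities, which persist when [n] is raised
   to [k]. *)
have [U leU disU] := colorable_color_sets colG.
have union_le (A B : {set 'I_n}) : [disjoint A & B] -> #|A| + #|B| <= n.
  move=> /disjoint_setI0 AB; have := max_card [in A :|: B].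
  by rewrite card_ord cardsU AB cards0 subn0.
have edge (i j : C5) : adj i j -> m i + m j <= k.
  move=> /disU/union_le; have := leU i; have := leU j; lia.
set i0 : C5 := @Ordinal 5 0 isT; set i1 : C5 := @Ordinal 5 1 isT.
set i2 : C5 := @Ordinal 5 2 isT; set i3 : C5 := @Ordinal 5 3 isT.
set i4 : C5 := @Ordinal 5 4 isT.
apply: set_game_indicated_colorable.
have -> : [ffun=> set0] =
    pentagon [:: set0; set0; set0; set0; set0 : {set 'I_k}].
  by apply/ffunP=> -[[|[|[|[|[|i]]]]] lti]; rewrite !ffunE.
have total : m i0 + m i1 + m i2 + m i3 + m i4 <= 2 * k.
  (* Both [#|U i0 :|: U i2| + #|U i1|] and [#|U i0 :&: U i2| + #|U i3| + #|U i4|] are at most [n];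
     their sum is the total size of the five sets. *)
  have := union_le (U i0 :|: U i2) (U i1).
  have := cardsUI (U i0) (U i2).
  have := union_le (U i0 :&: U i2) (U i3 :|: U i4).
  have := cardsUI (U i3) (U i4).
  have -> : U i3 :&: U i4 = set0 by apply/disjoint_setI0/disU.
  have -> : [disjoint U i0 :&: U i2 & U i3 :|: U i4].
    rewrite disjoint_setUr; apply/andP; split.
      by apply: disjointWl (subsetIr _ _) _; apply: disU.
    by apply: disjointWl (subsetIl _ _) _; apply: disU.
  have -> : [disjoint U i0 :|: U i2 & U i1].
    by rewrite disjoint_sym disjoint_setUr !disU.
  have := leU i0; have := leU i1; have := leU i2.
  have := leU i3; have := leU i4; rewrite cards0; lia.
apply: (pentagon_won (card_ord k)) => //; first by split; apply: edge.
- by rewrite cards0.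
- by rewrite cards0.
- by rewrite set0I cards0 edge.
by rewrite set0U cards0 (leq_trans (leq_addl (m i0) _) (edge i0 i1 isT)).
Qed.
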